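(* Let $\mathcal{X}$ be a stochastic, irreducible and aperiodic homogeneous discrete-time Markov chain on a countably infinite state space $S$. If $\mathcal{X}$ is simple and recurrent, then $\mathcal{X}$ is asymptotically aperiodic.
   Context: $\mathcal{X}=\{X(n),\,n=0,1,\dots\}$ has an arbitrary initial distribution, and $\mathbb{P}$ is the induced probability measure on sample paths. For $m\ge 1$, $\mathcal{X}^{(m)}=\{X^{(m)}(n)=X(nm),\ n=0,1,\dots\}$ is the $m$-step chain. For a Markov chain $\mathcal{Y}=\{Y(n)\}$ on $S$ (here $\mathcal{X}$ or some $\mathcal{X}^{(m)}$) and $C\subset S$ let $U(C)=\{Y(n)\in C \text{ for infinitely many } n\}$ and $L(C)=\{Y(n)\in C\text{ for all sufficiently large }n\}$. $C$ is transient (w.r.t. $\mathcal{Y}$) if $\mathbb{P}(U(C))=0$; regular if $\mathbb{P}(U(C)\setminus L(C))=0$; almost closed if it is regular and not transient. These notions do not depend on the initial distribution. An almost closed set is atomic if it does not contain two disjoint almost closed subsets, and nonatomic otherwise. Two regular sets are equivalent if their symmetric difference is transient. A Blackwell decomposition of $S$ for $\mathcal{Y}$ is a finite or countable collection $\{C_1,C_2,\dots\}$ of disjoint almost closed sets such that (i) every $C_i$, except at most one, is atomic; (ii) the nonatomic $C_i$, if present, contains no atomic subsets and consists of transient states; (iii) $\sum_i\mathbb{P}(L(C_i))=1$. By a theorem of Blackwell such a decomposition exists and is unique up to equivalence; $\beta(\mathcal{Y})$ denotes the number of sets in it. $\mathcal{Y}$ is simple if $\beta(\mathcal{Y})=1$.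 The asymptotic period of a simple chain $\mathcal{X}$ is $d(\mathcal{X}):=\sup\{m\ge1 : \beta(\mathcal{X}^{(m)})=m\}\in\{1,2,\dots\}\cup\{\infty\}$; $\mathcal{X}$ is asymptotically aperiodic if $d(\mathcal{X})=1$. *)

(* Defs.v *)
From mathcomp Require Import all_boot all_order all_algebra.
From mathcomp Require Import all_classical all_reals all_analysis.

Set Implicit Arguments.
Unset Strict Implicit.
Unset Printing Implicit Defensive.

Import Order.TTheory GRing.Theory Num.Theory.

Local Open Scope classical_set_scope.
Local Open Scope ring_scope.
Local Open Scope ereal_scope.

(* Transition matrices have extended-real entries so that the row sums and the
   powers below are plain [esum]s; [stochastic] forces all entries into [0, 1]. *)
Definition stochastic (R : realType) (S : countType) (p : S -> S -> \bar R) :=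
  (forall i j, 0 <= p i j) /\ (forall i, \esum_(j in [set: S]) p i j = 1).

Fixpoint tpow (R : realType) (S : countType) (p : S -> S -> \bar R)
    (n : nat) (i j : S) : \bar R :=
  if n is n'.+1 then \esum_(k in [set: S]) (p i k * tpow p n' k j)
  else if i == j then 1 else 0.

Definition irreducible (R : realType) (S : countType) (p : S -> S -> \bar R) :=
  forall i j, exists n, 0 < tpow p n i j.

(* [t] is the gcd of the return times { n >= 1 | p^n(i,i) > 0 }; for an empty
   set of return times this makes the period 0. *)
Definition is_period (R : realType) (S : countType) (p : S -> S -> \bar R)
    (i : S) (t : nat) :=
  (forall n, (0 < n)%N -> 0 < tpow p n i i -> (t %| n)%N) /\
  (forall e, (forall n, (0 < n)%N -> 0 < tpow p n i i -> (e %| n)%N) ->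
     (e %| t)%N).

Definition aperiodic (R : realType) (S : countType) (p : S -> S -> \bar R) :=
  forall i, is_period p i 1.

(* Probability that the chain started in [i] first visits [j], after time 0,
   exactly at time [n.+1]. *)
Fixpoint first_passage (R : realType) (S : countType) (p : S -> S -> \bar R)
    (j : S) (n : nat) (i : S) : \bar R :=
  if n is n'.+1 then
    \esum_(k in [set k | k != j]) (p i k * first_passage p j n' k)
  else p i j.

Definition return_prob (R : realType) (S : countType) (p : S -> S -> \bar R)
    (i : S) : \bar R := \sum_(0 <= n <oo) first_passage p i n i.

Definition recurrent_state (R : realType) (S : countType)
  (p : S -> S -> \bar R) (i : S) := return_prob p i = 1.

Definition transient_state (R : realType) (S : countType)
  (p : S -> S -> \bar R) (i : S) := return_prob p i < 1.

Definition recurrent (R : realType) (S : countType) (p : S -> S -> \bar R) :=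
  forall i, recurrent_state p i.

(* [X] is a homogeneous Markov chain with transition matrix [p]; the law of
   [X 0] is arbitrary. The last clause is the Markov property
   P(X(n+1) = s(n+1) | X(0) = s(0), ..., X(n) = s(n)) = p(s(n), s(n+1))
   multiplied by the probability of the conditioning event. *)
Definition markov_chain (R : realType) (S : countType) (d : measure_display)
    (Omega : measurableType d) (Pr : probability Omega R)
    (p : S -> S -> \bar R) (X : nat -> Omega -> S) :=
  [/\ stochastic p,
      (forall n s, measurable [set w | X n w = s]) &
      (forall (n : nat) (s : nat -> S),
         Pr [set w | forall k, (k <= n.+1)%N -> X k w = s k] =
         Pr [set w | forall k, (k <= n)%N -> X k w = s k] * p (s n) (s n.+1))].

Definition mstep (S Omega : Type) (X : nat -> Omega -> S) (m : nat)
  : nat -> Omega -> S := fun n => X (n * m)%N.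

Definition visits_io (S Omega : Type) (Y : nat -> Omega -> S) (C : set S)
  : set Omega := [set w | infinite_set [set n | C (Y n w)]].

Definition visits_ev (S Omega : Type) (Y : nat -> Omega -> S) (C : set S)
  : set Omega := [set w | \forall n \near \oo, C (Y n w)].

Definition transient_set (R : realType) (S : countType) (d : measure_display)
    (Omega : measurableType d) (Pr : probability Omega R)
    (Y : nat -> Omega -> S) (C : set S) :=
  Pr (visits_io Y C) = 0.

Definition regular_set (R : realType) (S : countType) (d : measure_display)
    (Omega : measurableType d) (Pr : probability Omega R)
    (Y : nat -> Omega -> S) (C : set S) :=
  Pr (visits_io Y C `\` visits_ev Y C) = 0.

Definition almost_closed (R : realType) (S : countType) (d : measure_display)
    (Omega : measurableType d) (Pr : probability Omega R)
    (Y : nat -> Omega -> S) (C : set S) :=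
  regular_set Pr Y C /\ ~ transient_set Pr Y C.

Definition splits (R : realType) (S : countType) (d : measure_display)
    (Omega : measurableType d) (Pr : probability Omega R)
    (Y : nat -> Omega -> S) (C : set S) :=
  exists A B : set S, [/\ A `<=` C, B `<=` C, A `&` B = set0,
    almost_closed Pr Y A & almost_closed Pr Y B].

Definition atomic_set (R : realType) (S : countType) (d : measure_display)
    (Omega : measurableType d) (Pr : probability Omega R)
    (Y : nat -> Omega -> S) (C : set S) :=
  almost_closed Pr Y C /\ ~ splits Pr Y C.

Definition nonatomic_set (R : realType) (S : countType) (d : measure_display)
    (Omega : measurableType d) (Pr : probability Omega R)
    (Y : nat -> Omega -> S) (C : set S) :=
  almost_closed Pr Y C /\ splits Pr Y C.

(* [q] is the transition matrix of [Y]; it only serves to say which states are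
   transient. *)
Definition blackwell_decomposition (R : realType) (S : countType)
    (d : measure_display) (Omega : measurableType d) (Pr : probability Omega R)
    (q : S -> S -> \bar R) (Y : nat -> Omega -> S) (D : set (set S)) :=
  [/\ countable D /\ trivIset D id,
      (forall C, D C -> almost_closed Pr Y C),
      (forall C C', D C -> D C' ->
         nonatomic_set Pr Y C -> nonatomic_set Pr Y C' -> C = C'),
      (forall C, D C -> nonatomic_set Pr Y C ->
         (forall A, A `<=` C -> ~ atomic_set Pr Y A) /\
         C `<=` [set i | transient_state q i]) &
      \esum_(C in D) Pr (visits_ev Y C) = 1].

(* Number of sets (possibly +oo) in a decomposition picked by choice: all of
   them have the same size, by uniqueness up to equivalence. Were there no
   decomposition, the value would be 0, the size of the default set0. *)
Definition beta (R : realType) (S : countType) (d : measure_display)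
    (Omega : measurableType d) (Pr : probability Omega R)
    (q : S -> S -> \bar R) (Y : nat -> Omega -> S) : \bar R :=
  counting (get (blackwell_decomposition Pr q Y)).

Definition simple_chain (R : realType) (S : countType) (d : measure_display)
    (Omega : measurableType d) (Pr : probability Omega R)
    (q : S -> S -> \bar R) (Y : nat -> Omega -> S) :=
  beta Pr q Y = 1.

Definition asymptotic_period (R : realType) (S : countType)
    (d : measure_display) (Omega : measurableType d) (Pr : probability Omega R)
    (p : S -> S -> \bar R) (X : nat -> Omega -> S) : \bar R :=
  ereal_sup [set (m%:R)%:E | m in
    [set m : nat | (1 <= m)%N /\
       beta Pr (tpow p m) (mstep X m) = (m%:R)%:E]].

Definition asymptotically_aperiodic (R : realType) (S : countType)
    (d : measure_display) (Omega : measurableType d) (Pr : probability Omega R)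
    (p : S -> S -> \bar R) (X : nat -> Omega -> S) :=
  asymptotic_period Pr p X = 1.

(* Main.v *)
(* Fix [m >= 1] and a state [b], and write [u n] for [p^n(b,b)]. Recurrence and
   the renewal equation give [sum_n u n = oo]; aperiodicity puts return times
   to [b] in every residue class mod [m], so already the sum of [u n] over the
   multiples [n] of [m] diverges. Started in [b], the chain has at time [N] made
   a last visit to [b] at some multiple of [m]; summing over the time of this
   visit shows that [sum_(n < N, m | n) u n * c N <= 1], where [c N] is the
   probability of not coming back to [b] at a multiple of [m] up to time [N].
   Hence [c N] tends to 0, and so the [m]-step chain visits [b] infinitely often
   almost surely from every state. As [b] is arbitrary, the whole space is the
   only almost closed set of the [m]-step chain, and its Blackwell decomposition
   cannot have [m >= 2] members. *)

Require Import Defs.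
From mathcomp Require Import all_boot all_order all_algebra.
From mathcomp Require Import all_classical all_reals all_analysis.
From mathcomp Require Import zify.

Set Implicit Arguments.
Unset Strict Implicit.
Unset Printing Implicit Defensive.

Import Order.TTheory GRing.Theory Num.Theory.

Local Open Scope classical_set_scope.
Local Open Scope ring_scope.
Local Open Scope ereal_scope.

(** * Sums of nonnegative extended reals over arbitrary index sets *)

Section esum_complements.
Context {R : realType}.

Lemma esum_ge_term (T : choiceType) (D : set T) (a : T -> \bar R) (t : T) :
  (forall x, D x -> 0 <= a x) -> D t -> a t <= \esum_(x in D) a x.
Proof.
move=> a0 Dt; apply: esum_ge; exists [set t].
  by split; [exact: finite_set1|move=> _ ->].
by rewrite fsbig_set1.
Qed.

Lemma esumZl (T : choiceType) (D : set T) (a : T -> \bar R) (x : \bar R) :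
  0 <= x -> (forall t, 0 <= a t) ->
  \esum_(t in D) (x * a t) = x * \esum_(t in D) a t.
Proof.
move=> x0 a0; have E0 : 0 <= \esum_(t in D) a t by apply: esum_ge0.
case: x x0 => [r| |//] x0.
  rewrite /esum -ereal_supZl//; last first.
    by apply/set0P; exists (\sum_(t \in set0) a t); exists set0 => //;
       exact: fsets_set0.
  congr ereal_sup; rewrite image_comp; apply: eq_imagel => A _ /=.
  by rewrite ge0_mule_fsumr.
(* For [x = +oo] both sides are 0 if all terms vanish, and [+oo] as soon as one term is positive. *)
have [aD0|] := pselect (forall t, D t -> a t = 0).
  by rewrite !esum1 ?mule0// => t Dt; rewrite aD0 ?mule0.
move=> /existsNP[t] /not_implyP[Dt /eqP at0].
have {at0} at_gt0 : 0 < a t by rewrite lt_neqAle eq_sym at0 a0.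
have Dgt0 : 0 < \esum_(t in D) a t.
  by apply: lt_le_trans at_gt0 _; apply: esum_ge_term.
rewrite (gt0_mulye Dgt0); apply/eqP; rewrite -leye_eq -[leLHS](gt0_mulye at_gt0).
have := @esum_ge_term _ D (fun t => +oo * a t) t.
by apply=> // s _; exact: mule_ge0.
Qed.

Lemma esumZr (T : choiceType) (D : set T) (a : T -> \bar R) (x : \bar R) :
  0 <= x -> (forall t, 0 <= a t) ->
  \esum_(t in D) (a t * x) = (\esum_(t in D) a t) * x.
Proof.
by move=> x0 a0; rewrite muleC -esumZl//; apply: eq_esum => t _; rewrite muleC.
Qed.

Lemma esum_exchange (T U : choiceType) (D : set T) (E : set U)
    (a : T -> U -> \bar R) : (forall t u, 0 <= a t u) ->
  \esum_(t in D) \esum_(u in E) a t u = \esum_(u in E) \esum_(t in D) a t u.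
Proof.
move=> a0; rewrite !esum_esum//.
rewrite (@reindex_esum _ _ _ (E `*`` fun=> D) _ (fun z => (z.2, z.1)))//.
split=> [[u t] /= []//|[u t] [v s] _ _ [-> ->]//|[t u] /= [Dt Eu]].
by exists (u, t).
Qed.

Lemma esum_pred1 (T : choiceType) (a : T -> \bar R) (t : T) :
  (forall x, 0 <= a x) ->
  \esum_(x in [set: T]) (a x * (if x == t then 1 else 0)) = a t.
Proof.
move=> a0; rewrite -[RHS]esum_set1// [RHS]esum_mkcond; apply: eq_esum => x _.
by rewrite in_set1; case: eqP => _; rewrite ?mule1 ?mule0.
Qed.

End esum_complements.

(** * Powers of the transition matrix and first passages *)

Section powers.
Context {R : realType} {S : countType} (p : S -> S -> \bar R).
Hypothesis p_ge0 : forall i j, 0 <= p i j.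

Lemma tpow_ge0 n i j : 0 <= tpow p n i j.
Proof.
case: n i => [|n] i /=; first by case: ifP.
elim: n i => [|n IH] i; apply: esum_ge0 => k _; apply: mule_ge0 => //=.
by case: ifP.
Qed.

Lemma tpowS n i j :
  tpow p n.+1 i j = \esum_(k in [set: S]) (p i k * tpow p n k j).
Proof. by []. Qed.

Lemma tpow1 : tpow p 1 = p.
Proof. by apply/funext => i; apply/funext => j /=; rewrite esum_pred1. Qed.

Lemma tpowD m n i j :
  tpow p (m + n) i j = \esum_(k in [set: S]) (tpow p m i k * tpow p n k j).
Proof.
elim: m i => [|m IH] i /=.
  under eq_esum do rewrite muleC eq_sym.
  by rewrite esum_pred1// => k; exact: tpow_ge0.
transitivity (\esum_(l in [set: S]) \esum_(k in [set: S])
    (p i l * (tpow p m l k * tpow p n k j))).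
  apply: eq_esum => l _; rewrite IH esumZl// => k.
  by rewrite mule_ge0// tpow_ge0.
rewrite esum_exchange; last by move=> l k; rewrite !mule_ge0// tpow_ge0.
apply: eq_esum => k _; rewrite -esumZr ?tpow_ge0//.
  by apply: eq_esum => l _; rewrite muleA.
by move=> l; rewrite mule_ge0// tpow_ge0.
Qed.

Lemma tpowD_ge m n i k j :
  tpow p m i k * tpow p n k j <= tpow p (m + n) i j.
Proof.
rewrite tpowD.
apply: (@esum_ge_term _ _ _ (fun k => tpow p m i k * tpow p n k j) k) => // l _.
by rewrite mule_ge0// tpow_ge0.
Qed.

Lemma tpowD_gt0 m n i k j : 0 < tpow p m i k -> 0 < tpow p n k j ->
  0 < tpow p (m + n) i j.
Proof. by move=> ik kj; apply: lt_le_trans (tpowD_ge m n i k j); rewrite mule_gt0. Qed.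

Lemma tpow_row_sum n i : (forall i, \esum_(j in [set: S]) p i j = 1) ->
  \esum_(j in [set: S]) tpow p n i j = 1.
Proof.
move=> p1; elim: n i => [|n IH] i /=.
  under eq_esum do rewrite -[if _ then _ else _]mul1e eq_sym.
  by rewrite (@esum_pred1 _ _ (fun=> 1)).
rewrite esum_exchange; last by move=> k j; rewrite mule_ge0// tpow_ge0.
rewrite -[RHS](p1 i); apply: eq_esum => k _.
by rewrite esumZl ?IH ?mule1// => j; exact: tpow_ge0.
Qed.

Lemma first_passage_ge0 j n i : 0 <= first_passage p j n i.
Proof.
elim: n i => [|n IH] i //=; apply: esum_ge0 => k _.
by rewrite mule_ge0.
Qed.

(** The first visit to [j] happens at some time [k + 1] and leaves [n - k] steps. In the induction,
    a first step into [j] gives the term [k = 0]; a step elsewhere shifts the indices by one. *)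
Lemma tpow_first_passage n i j :
  tpow p n.+1 i j =
  \sum_(0 <= k < n.+1) (first_passage p j k i * tpow p (n - k) j j).
Proof.
elim: n i => [|n IH] i.
  by rewrite tpow1 big_nat1 /= eqxx mule1.
rewrite tpowS big_nat_recl// subn0 (esumID [set j]); last first.
  by move=> k _; rewrite mule_ge0// tpow_ge0.
rewrite !setTI esum_set1; last by rewrite mule_ge0// tpow_ge0.
congr (_ + _).
transitivity (\esum_(k in [set k | k != j]) \sum_(0 <= l < n.+1)
    (p i k * first_passage p j l k * tpow p (n - l) j j)).
  have -> : ~` [set j] = [set k | k != j] by apply/seteqP; split=> k /eqP.
  apply: eq_esum => k _.
  rewrite IH ge0_sume_distrr.
    by apply: eq_bigr => l _; rewrite muleA.
  by move=> l _; rewrite mule_ge0 ?first_passage_ge0 ?tpow_ge0.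
rewrite esum_sum; last first.
  by move=> k l _ _; rewrite !mule_ge0 ?first_passage_ge0 ?tpow_ge0.
apply: eq_bigr => l _; rewrite esumZr ?subSS ?tpow_ge0//.
by move=> k; rewrite mule_ge0 ?first_passage_ge0.
Qed.

End powers.

(** * Residues of an additive set of integers with gcd 1 *)

Lemma additive_set_residues (Q : nat -> Prop) (m r : nat) :
  Q 0%N -> (forall a b, Q a -> Q b -> Q (a + b)%N) ->
  (forall e, (forall n, (0 < n)%N -> Q n -> (e %| n)%N) -> (e %| 1)%N) ->
  (0 < m)%N -> exists2 s, Q s & (s = r %[mod m])%N.
Proof.
move=> Q0 QD Qgcd m_gt0.
(* Modulo [m] the set [Z] is a subgroup; its least positive member [e] divides every member of [Q],
   so the gcd condition gives [e = 1]. *)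
pose Z r := exists2 s, Q s & (s = r %[mod m])%N.
have ZD a b : Z a -> Z b -> Z (a + b)%N.
  move=> [s Qs sa] [t Qt tb]; exists (s + t)%N; first exact: QD.
  by rewrite -modnDm sa tb modnDm.
have ZM k a : Z a -> Z (k * a)%N.
  move=> Za; elim: k => [|k IH]; first by exists 0%N.
  by rewrite mulSn; exact: ZD.
have Zmod a b : (a = b %[mod m])%N -> Z a -> Z b.
  by move=> ab [s Qs sa]; exists s => //; rewrite sa.
have exZ : exists e, (0 < e)%N && `[< Z e >].
  exists m; rewrite m_gt0; apply/asboolP; exists 0%N => //.
  by rewrite modnn mod0n.
have [e /andP[e_gt0 /asboolP Ze] emin] := ex_minnP exZ.
have : (e %| 1)%N.
  apply: Qgcd => n _ Qn; rewrite /dvdn; case: posnP => // ne_gt0.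
  suff : (e <= n %% e)%N by rewrite leqNgt ltn_mod e_gt0.
  apply: emin; rewrite ne_gt0; apply/asboolP.
  (* Modulo [m], adding [m - 1] copies of a number amounts to subtracting it, so this is
     [n - (n %/ e) * e], the remainder. *)
  have : Z (n + m.-1 * (n %/ e) * e)%N.
    by apply: ZD; [exists n|exact: ZM].
  apply: Zmod; rewrite {1}(divn_eq n e).
  have -> : (n %/ e * e + n %% e + m.-1 * (n %/ e) * e =
             (n %/ e) * e * m + n %% e)%N.
    by rewrite -[in RHS](prednK m_gt0); lia.
  by rewrite modnMDl.
rewrite dvdn1 => /eqP e1; rewrite -/(Z r) -[r]muln1 -e1.
exact: ZM.
Qed.

(** * Divergence of the series of return probabilities *)

Section recurrence.
Context {R : realType} {S : countType} (p : S -> S -> \bar R).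
Hypothesis p_ge0 : forall i j, 0 <= p i j.

(** Summed over [n], the renewal equation reads [U = 1 + F * U], where [F] is the return
    probability. With [F = 1] this excludes a finite [U]. *)
Lemma tpow_diag_series (j : S) : return_prob p j = 1 ->
  \sum_(0 <= n <oo) tpow p n j j = +oo.
Proof.
move=> rec_j; set U := (X in X = _).
pose u n := tpow p n j j; pose f n := first_passage p j n j.
have u0 n : 0 <= u n by exact: tpow_ge0.
have f0 n : 0 <= f n by exact: first_passage_ge0.
have UE : U = \esum_(n in [set: nat]) u n by rewrite -nneseries_esumT.
have shift k :
    \esum_(n in [set: nat]) (if (k <= n)%N then u (n - k)%N else 0) = U.
  rewrite UE; have -> : \esum_(n in [set: nat]) u n =
      \esum_(n in [set n | (k <= n)%N]) u (n - k)%N.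
    rewrite [RHS](@reindex_esum _ _ _ [set: nat] _ (fun n => n + k)%N).
      by apply: eq_esum => n _; rewrite addnK.
    split=> [n _ /=|a b _ _ /addIn//|n /= kn]; first exact: leq_addl.
    by exists (n - k)%N => //; rewrite subnK.
  rewrite [RHS]esum_mkcond; apply: eq_esum => n _.
  by rewrite mem_setE.
(* The convolution is extended by zero to [k > n], so that both sums run over all integers and can
   be exchanged. *)
pose h n k := f k * (if (k <= n)%N then u (n - k)%N else 0).
have h0 n k : 0 <= h n k by rewrite mule_ge0//; case: ifP.
have renew : U = 1 + U.
  rewrite {1}/U nneseries_recl//; last by move=> n _; exact: tpow_ge0.
  rewrite /= eqxx; congr (_ + _).
  rewrite -(@nneseries_addn _ u 1)//.
  rewrite (@eq_eseriesr _ _ (fun n => \esum_(k in [set: nat]) h n k)); last first.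
    move=> n _; rewrite addn1 /u tpow_first_passage// -nneseries_esumT//.
    rewrite (@nneseries_split _ _ 0 n.+1)// add0n.
    rewrite [X in _ + X]eseries0 ?adde0; last first.
      by move=> k nk _; rewrite /h leqNgt nk mule0.
    rewrite big_nat_cond [RHS]big_nat_cond; apply: eq_bigr => k.
    by rewrite andbT ltnS /h => /andP[_ ->].
  rewrite nneseries_esumT; last by move=> n; exact: esum_ge0.
  rewrite esum_exchange//.
  transitivity (\esum_(k in [set: nat]) (f k * U)).
    apply: eq_esum => k _; rewrite esumZl ?shift//.
    by move=> n; case: ifP.
  rewrite esumZr//; last by rewrite UE; apply: esum_ge0.
  by rewrite -nneseries_esumT// -/(return_prob p j) rec_j mul1e.
have : 0 <= U by rewrite UE; apply: esum_ge0.
case: U renew {UE shift} => [x| |]//; rewrite -EFinD => -[] /eqP.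
by rewrite eq_sym -subr_eq0 addrK oner_eq0.
Qed.

(** By contraposition: a return time [s] congruent to [-r] shifts the residue class [r] into the
    multiples of [m], and [u n * u s <= u (n + s)] with [u s > 0] bounds the sum over that class. *)
Lemma tpow_multiples_series (m : nat) (j : S) : (0 < m)%N ->
  (forall r, exists2 s, 0 < tpow p s j j & (s = r %[mod m])%N) ->
  \sum_(0 <= n <oo) tpow p n j j = +oo ->
  \sum_(0 <= n <oo | (m %| n)%N) tpow p n j j = +oo.
Proof.
move=> m_gt0 residues; apply: contra_eq; rewrite -!ltey => mult_fin.
pose u n := tpow p n j j.
have u0 n : 0 <= u n by exact: tpow_ge0.
pose g r n := if (n %% m == r)%N then u n else 0.
have g0 r n : 0 <= g r n by rewrite /g; case: ifP.
have gE : \sum_(0 <= n <oo | (m %| n)%N) u n = \sum_(0 <= n <oo) g 0%N n.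
  by rewrite eseries_mkcond.
have -> : \sum_(0 <= n <oo) u n = \sum_(0 <= r < m) \sum_(0 <= n <oo) g r n.
  rewrite -nneseries_sum_nat//; apply: eq_eseriesr => n _.
  rewrite (bigD1_seq (n %% m)%N) ?iota_uniq ?mem_index_iota ?ltn_mod//=.
  rewrite /g eqxx big1 ?adde0// => r; rewrite eq_sym.
  by move/negbTE => ->.
apply: lte_sum_pinfty => r _.
have [s us_gt0 sr] := residues (m - r %% m)%N.
rewrite ltey; apply/eqP => gr_oo.
suff : +oo <= \sum_(0 <= n <oo) g 0%N n by rewrite -gE leNgt mult_fin.
rewrite -[leLHS](gt0_muley us_gt0) -gr_oo nneseries_esumT// -esumZl//; last first.
  exact: ltW.
rewrite -nneseries_esumT; last by move=> n; rewrite mule_ge0// ltW.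
rewrite [leRHS](@nneseries_split _ _ 0 s)// add0n -[X in _ + X]nneseries_addn//.
apply: (@le_trans _ _ (\sum_(0 <= n <oo) g 0%N (n + s)%N)); last first.
  by rewrite leeDr// sume_ge0.
apply: lee_nneseries => [n _ _|n _].
  by rewrite mule_ge0// ltW.
rewrite /g /=; case: eqP => nr; last by rewrite mule0; case: ifP.
have -> : ((n + s) %% m == 0)%N.
  by rewrite -modnDmr sr modnDmr -nr modn_mod -modnDml subnKC ?modnn// ltnW// ltn_mod.
by rewrite muleC; exact: tpowD_ge.
Qed.

End recurrence.

(** * Avoiding a state at the multiples of [m] *)

Section avoidance.
Context {R : realType} {S : countType} (p : S -> S -> \bar R).
Hypothesis p_stoch : stochastic p.
Variables (m : nat) (b : S).

Let p_ge0 i j : 0 <= p i j := p_stoch.1 i j.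
Let p_sum i : \esum_(j in [set: S]) p i j = 1 := p_stoch.2 i.

(* The probability, given [X n = i], that [X k != b] for every multiple [k] of
   [m] with [n <= k < n + L]. *)
Fixpoint avoid_prob (L n : nat) (i : S) : \bar R :=
  if L is L'.+1 then
    if (m %| n)%N && (i == b) then 0
    else \esum_(k in [set: S]) (p i k * avoid_prob L' n.+1 k)
  else 1.

(** This is [c] of the outline: the probability, from [b] at time 0, of missing [b] at all multiples
    of [m] among the times [1, ..., L]. *)
Let escape_prob L : \bar R := \esum_(k in [set: S]) (p b k * avoid_prob L 1 k).

Lemma tpow_le1 n i j : tpow p n i j <= 1.
Proof.
rewrite -(tpow_row_sum p_ge0 n i p_sum).
by apply: esum_ge_term => // k _; exact: tpow_ge0.
Qed.

Let avoid_probS L n i : avoid_prob L.+1 n i =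
  if (m %| n)%N && (i == b) then 0
  else \esum_(k in [set: S]) (p i k * avoid_prob L n.+1 k).
Proof. by []. Qed.

Lemma avoid_prob_ge0 L n i : 0 <= avoid_prob L n i.
Proof.
elim: L n i => [|L IH] n i //=; case: ifP => // _.
by apply: esum_ge0 => k _; rewrite mule_ge0.
Qed.

Lemma avoid_prob_le1 L n i : avoid_prob L n i <= 1.
Proof.
elim: L n i => [|L IH] n i //=; case: ifP => // _; rewrite -(p_sum i).
by apply: le_esum => k _; rewrite -[leRHS]mule1 lee_wpmul2l.
Qed.

Lemma avoid_probS_le L n i : avoid_prob L.+1 n i <= avoid_prob L n i.
Proof.
elim: L n i => [|L IH] n i; first exact: (avoid_prob_le1 1).
rewrite avoid_probS [leRHS]avoid_probS; case: ifP => // _.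
by apply: le_esum => k _; rewrite lee_wpmul2l.
Qed.

Lemma avoid_prob_antitone L L' n i : (L <= L')%N ->
  avoid_prob L' n i <= avoid_prob L n i.
Proof.
move=> /subnK <-; elim: (L' - L)%N => // k IH.
exact: le_trans (avoid_probS_le _ _ _) IH.
Qed.

Lemma avoid_prob_periodic L t n i : (m %| t)%N ->
  avoid_prob L (t + n) i = avoid_prob L n i.
Proof.
move=> mt; elim: L n i => //= L IH n i.
rewrite dvdn_addr//; case: ifP => // _.
by apply: eq_esum => k _; rewrite -addnS IH.
Qed.

Let escape_prob_ge0 L : 0 <= escape_prob L.
Proof. by apply: esum_ge0 => k _; rewrite mule_ge0// avoid_prob_ge0. Qed.

Let escape_prob_antitone L L' : (L <= L')%N -> escape_prob L' <= escape_prob L.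
Proof.
by move=> LL'; apply: le_esum => k _; rewrite lee_wpmul2l// avoid_prob_antitone.
Qed.

(** At [b] and a multiple of [m], [avoid_prob L.+1] is 0; the continuation from there has
    probability [escape_prob L], since time matters only modulo [m]. *)
Let avoid_prob_step L n i :
  \esum_(k in [set: S]) (p i k * avoid_prob L n.+1 k) =
  avoid_prob L.+1 n i + (if (m %| n)%N && (i == b) then escape_prob L else 0).
Proof.
rewrite /=; case: ifP => [/andP[mn /eqP ->]|_]; last by rewrite adde0.
rewrite add0e; apply: eq_esum => k _.
by rewrite -addn1 avoid_prob_periodic.
Qed.

(* Decomposition according to the last visit to [b] at a multiple of [m]. *)
Let avoid_prob_last_visit N L :
  \esum_(k in [set: S]) (tpow p N b k * avoid_prob L N k) =
  avoid_prob (N + L) 0 b + \sum_(0 <= n < N | (m %| n)%N)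
    (tpow p n b b * escape_prob (N - n.+1 + L)).
Proof.
elim: N L => [|N IH] L.
  rewrite big_geq// adde0 add0n /=.
  under eq_esum do rewrite muleC eq_sym.
  by rewrite esum_pred1// => k; exact: avoid_prob_ge0.
transitivity (\esum_(i in [set: S]) (tpow p N b i *
    \esum_(k in [set: S]) (p i k * avoid_prob L N.+1 k))).
  transitivity (\esum_(k in [set: S]) \esum_(i in [set: S])
      (tpow p N b i * (p i k * avoid_prob L N.+1 k))).
    apply: eq_esum => k _; rewrite -addn1 tpowD// tpow1// -esumZr.
    - by apply: eq_esum => i _; rewrite muleA.
    - exact: avoid_prob_ge0.
    - by move=> i; rewrite mule_ge0// tpow_ge0.
  rewrite esum_exchange; last first.
    by move=> k i; rewrite !mule_ge0// ?tpow_ge0// avoid_prob_ge0.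
  apply: eq_esum => i _; rewrite esumZl ?tpow_ge0// => k.
  by rewrite mule_ge0// avoid_prob_ge0.
under eq_esum => i _.
  rewrite avoid_prob_step ge0_muleDr ?avoid_prob_ge0//; last by case: ifP.
  over.
rewrite esumD; last 2 first.
- by move=> i _; rewrite mule_ge0 ?tpow_ge0// avoid_prob_ge0.
- by move=> i _; rewrite mule_ge0 ?tpow_ge0//; case: ifP.
(* The induction hypothesis, used with [L.+1], yields the terms [n < N]; what remains is the visit
   to [b] at time [N]. *)
rewrite IH addnS -addeA; congr (_ + _).
rewrite big_mkcond [RHS]big_mkcond big_nat_recr//=; congr (_ + _).
  apply: eq_big_nat => n /andP[_ nN]; case: ifP => // _.
  by congr (_ * escape_prob _); lia.
rewrite subnn add0n; case: ifP => mN.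
  rewrite -[RHS](@esum_pred1 _ _ (fun k => tpow p N b k * escape_prob L)).
    by apply: eq_esum => i _ /=; case: ifP => _; rewrite ?mule1 ?mule0.
  by move=> i; rewrite mule_ge0// tpow_ge0.
by rewrite esum1// => i _; rewrite mule0.
Qed.

Let avoid_mass_le1 N L :
  \esum_(k in [set: S]) (tpow p N b k * avoid_prob L N k) <= 1.
Proof.
rewrite -(tpow_row_sum p_ge0 N b p_sum); apply: le_esum => k _.
by rewrite -[leRHS]mule1 lee_wpmul2l ?avoid_prob_le1// tpow_ge0.
Qed.

(** Take [L = 0] in the last-visit decomposition and drop its first term; every escape probability
    left has horizon at most [N], hence is at least [escape_prob N]. *)
Let visits_escape_le1 N :
  (\sum_(0 <= n < N | (m %| n)%N) tpow p n b b) * escape_prob N <= 1.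
Proof.
apply: le_trans (avoid_mass_le1 N 0); rewrite avoid_prob_last_visit.
rewrite ge0_sume_distrl; last by move=> n _; exact: tpow_ge0.
rewrite -[leLHS]add0e leeD ?avoid_prob_ge0//.
apply: lee_sum => n _; rewrite lee_wpmul2l ?tpow_ge0//.
by apply: escape_prob_antitone; rewrite addn0 leq_subr.
Qed.

Hypothesis visits_oo : \sum_(0 <= n <oo | (m %| n)%N) tpow p n b b = +oo.

Let escape_prob_small (e : R) : (0 < e)%R ->
  exists N, forall L, (N <= L)%N -> escape_prob L <= e%:E.
Proof.
move=> e_gt0; suff [N cN] : exists N, escape_prob N <= e%:E.
  by exists N => L NL; exact: le_trans (escape_prob_antitone NL) cN.
(* If [escape_prob] stayed above [e], all partial sums of the divergent series would be at most
   [1 / e]. *)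
apply/not_existsP => c_gt; have : +oo <= (e^-1)%:E :> \bar R; last by [].
rewrite -[leLHS]visits_oo.
apply: lime_le; first by apply: is_cvg_nneseries => n _ _; exact: tpow_ge0.
apply: nearW => N; rewrite -[leRHS]mul1e lee_pdivlMr//.
apply: le_trans (visits_escape_le1 N); rewrite lee_wpmul2l//.
  by apply: sume_ge0 => n _; exact: tpow_ge0.
by rewrite leNgt; apply/negP => /ltW /c_gt.
Qed.

(** A path from [b] is in [i] at time [N] with positive probability. Avoiding [b] in a long window
    from then on makes some multiple of [m] before [N] the last visit to [b], which has small
    probability. *)
Lemma avoid_prob_small (N : nat) (i : S) (e : R) :
  (m %| N)%N -> 0 < tpow p N b i -> (0 < e)%R ->
  exists L, avoid_prob L 0 i <= e%:E.
Proof.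
move=> mN bi_gt0 e_gt0.
have bi_fin : tpow p N b i \is a fin_num.
  by rewrite ge0_fin_numE ?tpow_ge0// (le_lt_trans (tpow_le1 _ _ _))// ltry.
have q_gt0 : (0 < fine (tpow p N b i))%R by rewrite fine_gt0// bi_gt0 -ge0_fin_numE// ltW.
(* [d] is chosen such that [N] terms of size [d] add up to at most [e] times [tpow p N b i]; the
   denominator [N + 1] also covers [N = 0]. *)
pose d := (e * fine (tpow p N b i) / N.+1%:R)%R.
have d_gt0 : (0 < d)%R by rewrite !mulr_gt0// invr_gt0.
have [L0 cL0] := escape_prob_small d_gt0.
exists L0.+1; rewrite -(avoid_prob_periodic _ _ _ mN) addn0.
rewrite -(@lee_pmul2l _ (tpow p N b i))// -[in leRHS](fineK bi_fin).
apply: (@le_trans _ _ (\sum_(0 <= n < N) d%:E)).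
  apply: (@le_trans _ _ (\esum_(k in [set: S])
      (tpow p N b k * avoid_prob L0.+1 N k))).
    apply: (@esum_ge_term _ _ _ (fun k => tpow p N b k * avoid_prob L0.+1 N k) i) => //.
    by move=> k _; rewrite mule_ge0 ?tpow_ge0// avoid_prob_ge0.
  (* The term without a visit vanishes, as the start at [b] is a visit at time 0; the window length
     [L0.+1] keeps its horizon positive. *)
  rewrite avoid_prob_last_visit addnS /= dvdn0 eqxx add0e big_mkcond/=.
  apply: lee_sum => n _; case: ifP => _; last by rewrite lee_fin ltW.
  rewrite -[leRHS]mul1e lee_pmul ?tpow_ge0 ?tpow_le1 ?cL0//.
  by rewrite (leq_trans (leqnSn _))// leq_addl.
rewrite sumEFin sumr_const_nat subn0 lee_fin mulrC.
have <- : (d *+ N.+1 = e * fine (tpow p N b i))%R.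
  by rewrite -mulr_natr divfK// pnatr_eq0.
by rewrite mulrSr lerDl ltW.
Qed.

End avoidance.

(** * Countable unions and measurability of tail events *)

Lemma measure_countable_subadditive (d : measure_display)
    (T : measurableType d) (R : realType) (mu : {measure set T -> \bar R})
    (I : countType) (A : set T) (F : I -> set T) :
  (forall i, measurable (F i)) -> measurable A -> A `<=` \bigcup_i F i ->
  mu A <= \esum_(i in [set: I]) mu (F i).
Proof.
move=> mF mA AF.
pose G n := if @pickle_inv I n is Some i then F i else set0.
have GP i : G (pickle i) = F i by rewrite /G pickleK_inv.
apply: (@le_trans _ _ (\sum_(0 <= n <oo) mu (G n))).
  apply: measure_sigma_subadditive => //.
    by move=> n; rewrite /G; case: (pickle_inv n).
  by move=> w /AF[i _ Fiw]; exists (pickle i) => //; rewrite GP.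
rewrite nneseries_esumT// (esumID (range (@pickle I)))//.
rewrite [X in _ + X]esum1; last first.
  move=> n [_ nI]; rewrite /G; case E: (@pickle_inv I n) => [i|]//.
  by case: nI; exists i => //; have := @pickle_invK I n; rewrite E.
rewrite adde0 setTI esum_image; last first.
  by move=> i j _ _; exact: (pcan_inj pickleK_inv).
by apply: le_esum => i _; rewrite GP.
Qed.

Lemma finite_natP (A : set nat) :
  finite_set A <-> \forall n \near \oo, ~ A n.
Proof.
split=> [/finite_seqP[s ->]|[N _ NA]].
  exists (\max_(i <- s) i).+1 => // n /= sn /= ns.
  by move: sn; rewrite ltnNge (leq_bigmax_seq n ns).
apply: (@sub_finite_set _ _ `I_N); last exact: finite_II.
by move=> n An /=; rewrite ltnNge; apply/negP => /NA.
Qed.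

Lemma visits_ioE (S Omega : Type) (Y : nat -> Omega -> S) (C : set S) :
  visits_io Y C = ~` visits_ev Y (~` C).
Proof.
by apply/seteqP; split=> w /= wC; [move/finite_natP => /wC|move/finite_natP => /wC].
Qed.

Section chain_measurability.
Context {S : countType} {d : measure_display} {Omega : measurableType d}.
Context (Y : nat -> Omega -> S).
Hypothesis mY : forall n s, measurable [set w | Y n w = s].

Lemma measurable_state_in n (C : set S) : measurable [set w | C (Y n w)].
Proof.
have -> : [set w | C (Y n w)] =
    \bigcup_s (if s \in C then [set w | Y n w = s] else set0).
  apply/seteqP; split=> [w Cw|w [s _]].
    by exists (Y n w) => //; rewrite mem_set.
  by case: ifP => //; rewrite inE => Cs /= ->.
apply: countable_bigcupT_measurable; first exact: countableP.
by move=> s; case: ifP.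
Qed.

Lemma measurable_visits_ev (C : set S) : measurable (visits_ev Y C).
Proof.
have -> : visits_ev Y C =
    \bigcup_N \bigcap_(n in [set n | (N <= n)%N]) [set w | C (Y n w)].
  by apply/seteqP; split=> w [N _ NC]; exists N => // n; exact: NC.
apply: bigcupT_measurable => N; apply: bigcap_measurableType => n _.
exact: measurable_state_in.
Qed.

Lemma measurable_visits_io (C : set S) : measurable (visits_io Y C).
Proof. by rewrite visits_ioE; apply: measurableC; exact: measurable_visits_ev. Qed.

End chain_measurability.

(** * Avoidance probabilities on sample paths *)

Section avoidance_event.
Context {R : realType} {S : countType} {d : measure_display}.
Context {Omega : measurableType d} (Pr : probability Omega R).
Context (p : S -> S -> \bar R) (X : nat -> Omega -> S).
Hypothesis X_chain : markov_chain Pr p X.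
Variables (m : nat) (b : S).

Let p_stoch : stochastic p. Proof. by case: X_chain. Qed.
Let mX n s : measurable [set w | X n w = s]. Proof. by case: X_chain. Qed.

Let follows n (s : nat -> S) :=
  [set w | forall k, (k <= n)%N -> X k w = s k].

Let avoids n L :=
  [set w | forall k, (n <= k < n + L)%N -> (m %| k)%N -> X k w != b].

Let follows_markov n s :
  Pr (follows n.+1 s) = Pr (follows n s) * p (s n) (s n.+1).
Proof. by case: X_chain => _ _; exact. Qed.

Let measurable_follows n s : measurable (follows n s).
Proof.
have -> : follows n s =
    \bigcap_(k in [set k | (k <= n)%N]) [set w | X k w = s k] by [].
by apply: bigcap_measurableType => k _; exact: mX.
Qed.

Let measurable_avoids n L : measurable (avoids n L).
Proof.
have -> : avoids n L = \bigcap_(k in [set k | (n <= k < n + L)%N && (m %| k)%N])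
    [set w | [set s | s != b] (X k w)].
  apply/seteqP; split=> w /= H k; first by case/andP; exact: H.
  by move=> nk mk; apply: H => /=; rewrite nk mk.
by apply: bigcap_measurableType => k _; exact: measurable_state_in.
Qed.

(** Induction on [L], splitting by the state at time [n + 1]. An upper bound suffices later, so
    subadditivity replaces additivity. *)
Let measure_avoids_le n L s :
  Pr (follows n s `&` avoids n L) <= Pr (follows n s) * avoid_prob p m b L n (s n).
Proof.
elim: L n s => [|L IH] n s.
  by rewrite /= mule1 le_measure ?inE//; exact: measurableI.
rewrite [avoid_prob _ _ _ _ _ _]/=; case: ifP => [/andP[mn /eqP snb]|_].
  rewrite mule0 (_ : _ `&` _ = set0) ?measure0//.
  apply/seteqP; split=> // w [ws wb].
  have : X n w != b by apply: wb mn; rewrite leqnn addnS ltnS leq_addr.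
  by rewrite ws// snb eqxx.
pose ext k := fun l => if l == n.+1 then k else s l.
have extE k l : (l <= n)%N -> ext k l = s l.
  by move=> ln; rewrite /ext ltn_eqF.
apply: (@le_trans _ _ (\esum_(k in [set: S])
    Pr (follows n.+1 (ext k) `&` avoids n.+1 L))).
  apply: measure_countable_subadditive.
  - by move=> k; exact: measurableI.
  - exact: measurableI.
  - move=> w [ws wb]; exists (X n.+1 w) => //; split=> k.
      rewrite leq_eqVlt => /predU1P[->|]; first by rewrite /ext eqxx.
      by rewrite ltnS => kn; rewrite ws// extE.
    by move=> /andP[nk kL]; apply: wb; rewrite (ltnW nk) addnS.
rewrite -esumZl ?measure_ge0//; last first.
  by move=> k; rewrite mule_ge0 ?avoid_prob_ge0// p_stoch.1.
apply: le_esum => k _; apply: le_trans (IH _ _) _.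
rewrite follows_markov.
have -> : follows n (ext k) = follows n s.
  by apply/seteqP; split=> w ws l ln; have := ws l ln; rewrite extE.
by rewrite extE// /ext eqxx muleA.
Qed.

Hypothesis m_gt0 : (0 < m)%N.
Hypothesis avoid_small : forall i (e : R), (0 < e)%R ->
  exists L, avoid_prob p m b L 0 i <= e%:E.

Lemma never_visits_null N :
  Pr [set w | forall n, (N <= n)%N -> mstep X m n w != b] = 0.
Proof.
set W := (X in Pr X).
have mW : measurable W.
  have -> : W = \bigcap_(n in [set n | (N <= n)%N])
      [set w | [set s | s != b] (X (n * m)%N w)] by [].
  by apply: bigcap_measurableType => n _; exact: measurable_state_in.
(* Histories up to time [N * m] are coded by finite sequences, of which there are only countably
   many; the default [b] pads those that are too short. *)
pose s (t : seq S) := nth b t.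
apply/eqP; rewrite -measure_le0.
apply: le_trans (@measure_countable_subadditive _ _ _ Pr (seq S) W
  (fun t => follows (N * m) (s t) `&` W) _ mW _) _.
- by move=> t; exact: measurableI.
- move=> w Ww; exists (mkseq (fun k => X k w) (N * m).+1) => //; split=> // k kNm.
  by rewrite /s nth_mkseq.
rewrite esum1// => t _; apply/eqP; rewrite eq_le measure_ge0 andbT.
apply/lee_addgt0Pr => e e_gt0; rewrite add0e.
have [L aL] := avoid_small (s t (N * m)%N) e_gt0.
apply: (@le_trans _ _ (Pr (follows (N * m) (s t) `&` avoids (N * m) L))).
  rewrite le_measure ?inE//; try exact: measurableI.
  move=> w [ws Ww]; split=> // k /andP[Nmk _] mk.
  by rewrite -(divnK mk); apply: Ww; rewrite leq_divRL.
apply: le_trans (measure_avoids_le _ _ _) _.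
rewrite -[leRHS]mul1e lee_pmul ?measure_ge0 ?avoid_prob_ge0 ?probability_le1//.
by rewrite -[X in avoid_prob _ _ _ _ X]addn0 avoid_prob_periodic ?dvdn_mull.
Qed.

(** A path that stays in [A] from time [N] on misses [b] from then on, and countably many null
    events have a null union. *)
Lemma visits_ev_null (A : set S) : ~ A b -> Pr (visits_ev (mstep X m) A) = 0.
Proof.
move=> Ab; have mY n s : measurable [set w | mstep X m n w = s] by exact: mX.
apply/(negligibleP Pr (measurable_visits_ev mY A)).
pose W N := [set w | forall n, (N <= n)%N -> mstep X m n w != b].
apply: (@negligibleS _ _ _ _ (\bigcup_N W N)).
  move=> w [N _ NA]; exists N => // n Nn; apply/eqP => Xb.
  by apply: Ab; rewrite -Xb; exact: NA.
apply: negligible_bigcup => N; apply/negligibleP; last exact: never_visits_null.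
have -> : W N = \bigcap_(n in [set n | (N <= n)%N])
    [set w | [set s | s != b] (X (n * m)%N w)] by [].
by apply: bigcap_measurableType => n _; exact: measurable_state_in.
Qed.

(** For regular [A], infinitely many visits mean an eventual stay up to a null set; the eventual
    stay is a null event as well, so [A] is transient. *)
Lemma not_almost_closed (A : set S) : ~ A b -> ~ almost_closed Pr (mstep X m) A.
Proof.
move=> Ab [regA]; apply; rewrite /transient_set.
have mY n s : measurable [set w | mstep X m n w = s] by exact: mX.
have mio := measurable_visits_io mY A; have mev := measurable_visits_ev mY A.
apply/(negligibleP Pr mio).
apply: (@negligibleS _ _ _ _
  (visits_ev (mstep X m) A `|` visits_io (mstep X m) A `\` visits_ev (mstep X m) A)).
  by move=> w iow; have [ev|nev] := pselect (visits_ev (mstep X m) A w); [left|right].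
apply: negligibleU; first by apply/(negligibleP Pr mev); exact: visits_ev_null.
by apply/negligibleP => //; exact: measurableD.
Qed.

End avoidance_event.

(** * Blackwell sets of the [m]-step chain and the asymptotic period *)

Lemma counting_set1_le1 (T : choiceType) (R : realType) (x : T) (A : set T) :
  A `<=` [set x] -> counting A <= 1 :> \bar R.
Proof.
rewrite /counting => /subset_set1[->|->].
  by rewrite asboolT ?fset_set0// finmap.cardfs0 lee_fin ler01.
by rewrite asboolT ?fset_set1// finmap.cardfs1.
Qed.

Section simple_recurrent_chain.
Context {R : realType} {S : countType} {d : measure_display}.
Context {Omega : measurableType d} (Pr : probability Omega R).
Context (p : S -> S -> \bar R) (X : nat -> Omega -> S).
Hypothesis X_chain : markov_chain Pr p X.
Hypothesis p_irreducible : irreducible p.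
Hypothesis p_aperiodic : aperiodic p.
Hypothesis p_recurrent : recurrent p.

Let p_stoch : stochastic p. Proof. by case: X_chain. Qed.
Let p_ge0 i j : 0 <= p i j. Proof. exact: p_stoch.1. Qed.

Lemma return_time_residue (m r : nat) (b : S) : (0 < m)%N ->
  exists2 s, 0 < tpow p s b b & (s = r %[mod m])%N.
Proof.
move=> m_gt0; apply: additive_set_residues => //.
- by rewrite /= eqxx lte01.
- by move=> s t; exact: tpowD_gt0.
- exact: (p_aperiodic b).2.
Qed.

Lemma mstep_almost_closed_setT (m : nat) (A : set S) : (0 < m)%N ->
  almost_closed Pr (mstep X m) A -> A = setT.
Proof.
move=> m_gt0 acA; apply/seteqP; split=> // b _; apply: contrapT => Ab.
apply: (@not_almost_closed _ _ _ _ _ _ _ X_chain m b m_gt0 _ A) => //.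
move=> i e e_gt0; have [k bi] := p_irreducible b i.
(* A return time congruent to [-k] makes [s + k] a multiple of [m], so that [i] is reached from [b]
   at such a time. *)
have [s bb sk] := return_time_residue (m - k %% m) b m_gt0.
apply: (@avoid_prob_small _ _ _ p_stoch m b _ (s + k) i) => //.
- apply: tpow_multiples_series => // [r|]; first exact: return_time_residue.
  by apply: tpow_diag_series => //; exact: p_recurrent.
- by rewrite /dvdn -modnDm sk modnDml addnC subnKC ?modnn// ltnW// ltn_mod.
- exact: tpowD_gt0 bb bi.
Qed.

Lemma beta_mstep_le1 (m : nat) (q : S -> S -> \bar R) : (0 < m)%N ->
  beta Pr q (mstep X m) <= 1.
Proof.
move=> m_gt0; apply: (@counting_set1_le1 _ _ setT) => C.
have [exD|noD] := pselect (exists D, blackwell_decomposition Pr q (mstep X m) D).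
  by have [_ acD _ _ _] := getPex exD; move=> /acD /mstep_almost_closed_setT ->.
(* Without a decomposition [get] returns the default [set0], and the inclusion is trivial. *)
by rewrite getPN//; exact/forallNP.
Qed.

End simple_recurrent_chain.

Theorem theorem7 (R : realType) (S : countType)
    (S_infinite : infinite_set (@setT S))
    (d : measure_display) (Omega : measurableType d) (Pr : probability Omega R)
    (p : S -> S -> \bar R) (X : nat -> Omega -> S)
    (X_chain : markov_chain Pr p X)
    (p_irreducible : irreducible p) (p_aperiodic : aperiodic p)
    (X_simple : simple_chain Pr p X) (p_recurrent : recurrent p) :
  asymptotically_aperiodic Pr p X.
Proof.
have [p_ge0 _] : stochastic p by case: X_chain.
(* Simplicity puts [m = 1] in the set whose supremum is the period; [beta_mstep_le1] excludes all
   larger [m]. *)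
have beta1 : beta Pr (tpow p 1) (mstep X 1) = 1.
  rewrite tpow1// (_ : mstep X 1 = X) //.
  by apply/funext => n; rewrite /mstep muln1.
rewrite /asymptotically_aperiodic /asymptotic_period -[RHS]ereal_sup1.
congr ereal_sup; apply/seteqP; split=> [_ [m [m_gt0 bm] <-]|_ ->].
  have := beta_mstep_le1 X_chain p_irreducible p_aperiodic p_recurrent
    (tpow p m) m_gt0.
  rewrite bm lee_fin lern1 => m_le1.
  by have /eqP -> : m == 1%N by rewrite eqn_leq m_le1.
by exists 1%N.
Qed.
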